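(* Let $a_0=0$ and, for $n\ge 1$, let $a_n$ be the $n$th entry of the infinite list $A$ defined below, and let $s_n=a_0+a_1+\cdots+a_n$. For each positive integer $h$, let $k(h)=\max\{k\ge 0 : s_k\le 2^h\}$, and let $T^h$ be the complete binary tree of height $h$. Then for each positive integer $h$, \[ \pi^*(T^h)\ge 2^h-k(h). \]
   Context: The list $A$: let $A_1=(5)$ and for $k\ge 2$ let $A_k$ be the concatenation $A_{k-1},A_{k-1},(1)$ (so $A_2=(5,5,1)$, $A_3=(5,5,1,5,5,1,1)$). Each $A_{k-1}$ is a prefix of $A_k$, and $A$ is the limiting infinite list. A complete binary tree of height $h$ is a rooted tree in which every non-leaf vertex has exactly two children and all leaves are at distance $h$ from the root. A pebbling configuration on a graph $G=(V,E)$ is a function $f:V\to\mathbb{Z}_{\ge 0}$. A pebbling move removes two pebbles from a vertex and places one pebble on an adjacent vertex. A configuration $f$ pebbles $G$ if for every vertex $v$ some (possibly empty) sequence of pebbling moves brings a pebble to $v$. The optimal pebbling number $\pi^*(G)$ is the minimum total number of pebbles $\sum_v f(v)$ over all configurations $f$ that pebble $G$. *)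

(* Defs.v *)
From mathcomp Require Import all_boot.
From mathcomp Require Import boolp.

Set Implicit Arguments.
Unset Strict Implicit.
Unset Printing Implicit Defensive.

(* [Alist k] is A_k for k >= 1; [Alist 0] is a dummy value. *)
Fixpoint Alist (k : nat) : seq nat :=
  match k with
  | 0 => [::]
  | 1 => [:: 5]
  | k'.+1 => Alist k' ++ Alist k' ++ [:: 1]
  end.

Lemma AlistSS k : Alist k.+2 = Alist k.+1 ++ Alist k.+1 ++ [:: 1].
Proof. by []. Qed.

Lemma size_Alist k : size (Alist k) = (2 ^ k).-1.
Proof.
elim: k => [//|[//|k] IH].
rewrite AlistSS !size_cat IH /= (expnS 2 k.+1) mul2n -addnn.
by have := expn_gt0 2 k.+1; case: (2 ^ k.+1) => // m _; rewrite addn1 /= addnS.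
Qed.

Lemma ltn_size_Alist n : n < size (Alist n.+1).
Proof. by rewrite size_Alist -ltnS prednK ?expn_gt0 // ltn_expl. Qed.

Lemma prefix_Alist k m : k <= m -> prefix (Alist k) (Alist m).
Proof.
elim: m => [|m IH]; first by rewrite leqn0 => /eqP->.
rewrite leq_eqVlt => /orP[/eqP->|]; first exact: prefix_refl.
rewrite ltnS => km; apply: prefix_trans (IH km) _.
by case: m {km IH} => [|m] //; rewrite AlistSS prefix_prefix.
Qed.

(* The n-th entry (counting from 1) of the limiting list A, read off A_n,     *)
(* which has 2^n - 1 >= n entries; by [aE], any A_k with at least n entries   *)
(* gives the same value.                                                      *)
Definition a (n : nat) : nat := if n is m.+1 then nth 0 (Alist n) m else 0.

Lemma aE k n : n < size (Alist k) -> a n.+1 = nth 0 (Alist k) n.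
Proof.
move=> nk; rewrite /a; have nn := ltn_size_Alist n.
have [kn|/ltnW nk'] := leqP k n.+1.
  by have /prefixP[t ->] := prefix_Alist kn; rewrite nth_cat nk.
by have /prefixP[t ->] := prefix_Alist nk'; rewrite nth_cat nn.
Qed.

Lemma a_gt0 n : 0 < a n.+1.
Proof.
suff pos k : all (leq 1) (Alist k).
  by move/allP: (pos n.+1); apply; rewrite mem_nth // ltn_size_Alist.
by elim: k => [//|[//|k] IH]; rewrite AlistSS !all_cat IH.
Qed.

Definition s (n : nat) : nat := \sum_(0 <= i < n.+1) a i.

Lemma leq_s n : n <= s n.
Proof.
elim: n => [//|n IH]; rewrite /s big_nat_recr //=.
by apply: leq_trans (leq_add IH (a_gt0 n)); rewrite addn1.
Qed.

Lemma ex_s_le h : exists k, s k <= 2 ^ h.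
Proof. by exists 0; rewrite /s big_nat1. Qed.

Lemma s_le_bound h k : s k <= 2 ^ h -> k <= 2 ^ h.
Proof. exact: leq_trans (leq_s k). Qed.

(* k(h) = max {k >= 0 : s_k <= 2^h} *)
Definition kmax (h : nat) : nat := ex_maxn (ex_s_le h) (@s_le_bound h).

(* Hence the truncated subtraction 2 ^ h - kmax h is the integer one. *)
Lemma kmax_le h : kmax h <= 2 ^ h.
Proof. by rewrite /kmax; case: ex_maxnP => k /s_le_bound. Qed.

Section Graph.

Variables (V : finType) (e : rel V).

Definition simple_graph : Prop := symmetric e /\ irreflexive e.

Definition connected_graph : Prop := forall x y : V, connect e x y.

(* The bound on the size excludes [:: x; y], which satisfies [ucycle e] as   *)
(* soon as xy is an edge.                                                     *)
Definition acyclic_graph : Prop := forall c : seq V, 2 < size c -> ~ ucycle e c.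

Definition is_tree : Prop :=
  [/\ simple_graph, connected_graph & acyclic_graph].

(* The length of a shortest path from x to y; the dummy value #|V| is         *)
(* returned when there is no path at all.                                     *)
Definition gdist (x y : V) : nat :=
  find (fun n => [exists p : n.-tuple V, path e x p && (last x p == y)])
       (iota 0 #|V|).

Definition children (r v : V) : {set V} :=
  [set w | e v w & gdist r w == (gdist r v).+1].

Definition is_leaf (r v : V) : bool := children r v == set0.

Definition complete_binary_tree (r : V) (h : nat) : Prop :=
  [/\ is_tree,
      forall v, ~~ is_leaf r v -> #|children r v| = 2
    & forall v, is_leaf r v -> gdist r v = h].

Definition config := {ffun V -> nat}.

Definition weight (f : config) : nat := \sum_v f v.

Definition move_result (f : config) (u v : V) : config :=
  [ffun w => if w == u then f w - 2 else if w == v then f w + 1 else f w].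

Inductive reachable (f : config) : config -> Prop :=
| reachable_refl : reachable f f
| reachable_move g u v :
    reachable f g -> e u v -> 2 <= g u -> reachable f (move_result g u v).

Definition pebbles (f : config) : Prop :=
  forall v, exists2 g, reachable f g & 0 < g v.

Lemma ex_pebbles : exists n, `[< exists2 f, pebbles f & weight f = n >].
Proof.
exists (weight [ffun=> 1]); apply/asboolP; exists [ffun=> 1] => // v.
by exists [ffun=> 1]; [exact: reachable_refl | rewrite ffunE].
Qed.

Definition optimal_pebbling_number : nat := ex_minn ex_pebbles.

End Graph.

(* Main.v *)
Require Import Defs.
From mathcomp Require Import all_boot.
From mathcomp Require Import boolp zify.

(** Let [n] be the number of pebbles and [saving n = \sum_(i >= 2) n %/ 2 ^ i],
    the 2-adic valuation of [(n./2)`!]. The list A is the concatenation over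
    [j >= 1] of the blocks 5, 1, ..., 1 with [logn 2 j] ones, so
    [s k <= n + k] as soon as [k <= saving n]; it thus suffices to show
    [2 ^ h <= n + saving n].

    For a subtree of height [k] containing [n] pebbles, able to gather [m] of
    them at its root, and all of whose leaves are reachable once [x] extra
    pebbles arrive at its root, induction on [k] gives simultaneously
      [2 ^ k <= x + n + saving n]  and  [2 ^ k.+1 + m <= 2 * x + 3 * n].
    If the two halves hold [n1 <= n2] pebbles, the linear bounds of both halves
    together with the first bound of the poorer half yield
      [2 ^ k.+1 <= x + n + (saving n1 + n1./2)],
    and [saving n1 + n1./2 = saving n1.*2 <= saving n]. *)

Set Implicit Arguments.
Unset Strict Implicit.
Unset Printing Implicit Defensive.

(** * The 2-adic valuation of factorials *)

Lemma logn2_fact_double n : logn 2 (n.*2)`! = n + logn 2 n`!.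
Proof.
elim: n => [//|n IH].
rewrite doubleS !factS !lognM ?muln_gt0 ?fact_gt0 // IH -doubleS -mul2n.
rewrite lognM // (lognE 2 n.*2.+1) /= dvdn2 /= odd_double /=.
rewrite (_ : logn 2 2 = 1) //; lia.
Qed.

Lemma logn2_fact n : logn 2 n`! = n./2 + logn 2 (n./2)`!.
Proof.
rewrite -logn2_fact_double -[in LHS](odd_double_half n).
case: (odd n) => //=; rewrite add1n factS lognM ?fact_gt0 //.
by rewrite lognE /= dvdn2 /= odd_double.
Qed.

Definition saving n := logn 2 (n./2)`!.

Lemma leq_saving m n : m <= n -> saving m <= saving n.
Proof.
move=> mn; apply: dvdn_leq_log; first exact: fact_gt0.
have : m./2 <= n./2 by lia.
move: (n./2) (m./2) => N M /subnKC <-; elim: (N - M) => [|d IH].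
  by rewrite addn0.
by rewrite addnS factS dvdn_mull.
Qed.

Lemma saving_add n1 n2 : n1 <= n2 -> n1./2 + saving n1 <= saving (n1 + n2).
Proof.
move=> n12; apply: leq_trans (leq_saving (_ : n1.*2 <= n1 + n2)); last by lia.
by rewrite /saving doubleK -logn2_fact.
Qed.

(** * Block structure and partial sums of the list A *)

Definition ruler_block j := 5 :: nseq (logn 2 j) 1.
Definition ruler_list l := flatten [seq ruler_block j | j <- iota 1 l].

Lemma ruler_listS l : ruler_list l.+1 = ruler_list l ++ ruler_block l.+1.
Proof. by rewrite /ruler_list -{1}[l.+1]addn1 iotaD map_cat flatten_cat /= cats0. Qed.

Lemma ruler_listD m d : ruler_list (m + d) =
  ruler_list m ++ flatten [seq ruler_block (m + j) | j <- iota 1 d].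
Proof.
rewrite /ruler_list iotaD map_cat flatten_cat addnC iotaDl -map_comp.
by congr (_ ++ flatten _); apply: eq_map => j.
Qed.

Lemma size_ruler_list l : size (ruler_list l) = l + logn 2 l`!.
Proof.
elim: l => [//|l IH]; rewrite ruler_listS size_cat IH /= size_nseq factS.
by rewrite lognM ?fact_gt0 //; lia.
Qed.

Lemma sumn_ruler_list l : sumn (ruler_list l) = 5 * l + logn 2 l`!.
Proof.
elim: l => [//|l IH]; rewrite ruler_listS sumn_cat IH /= sumn_nseq factS.
by rewrite lognM ?fact_gt0 //; lia.
Qed.

(** For [i <= k], [2 ^ i] divides both numbers or neither, and [0 < j < 2 ^ k] keeps [2 ^ k] from
    dividing either. *)
Lemma logn2_expD k j : 0 < j < 2 ^ k -> logn 2 (2 ^ k + j) = logn 2 j.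
Proof.
case/andP=> j0 jk; apply/eqP; rewrite eqn_leq; apply/andP.
have E i : i <= k -> (2 ^ i %| 2 ^ k + j) = (2 ^ i %| j).
  by move=> ik; rewrite dvdn_addr // dvdn_exp2l.
have lt i : 2 ^ i %| j -> i < k.
  move=> /(dvdn_leq j0) ij; rewrite -(ltn_exp2l _ _ (isT : 1 < 2)).
  exact: leq_ltn_trans ij jk.
have p2 : prime 2 by [].
have p0 : 0 < 2 ^ k + j by rewrite addn_gt0 j0 orbT.
split; rewrite -pfactor_dvdn //.
  have [ik|ki] := leqP (logn 2 (2 ^ k + j)) k.
    by rewrite -E // pfactor_dvdnn.
  have : 2 ^ k %| 2 ^ k + j.
    by apply: dvdn_trans (pfactor_dvdnn 2 _); rewrite dvdn_exp2l // ltnW.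
  by rewrite E // => /lt; rewrite ltnn.
have /lt ik := pfactor_dvdnn 2 j.
by rewrite E ?pfactor_dvdnn // ltnW.
Qed.

(** Shifting the index by [2 ^ k] preserves every block before the last one of the second copy; that
    block, of index [2 ^ k.+1], gains one 1, which is the 1 appended in [Alist k.+2]. *)
Lemma Alist_ruler k : Alist k.+1 = ruler_list (2 ^ k).
Proof.
elim: k => [//|k IH]; rewrite AlistSS IH expnS mul2n -addnn ruler_listD.
congr (_ ++ _); have := expn_gt0 2 k; case E: (2 ^ k) => [//|q] _.
rewrite ruler_listS (_ : iota 1 q.+1 = iota 1 q ++ [:: q.+1]);
  last by rewrite -{1}[q.+1]addn1 iotaD.
rewrite map_cat flatten_cat -catA.
congr (_ ++ _).
  congr flatten; apply/eq_in_map => j; rewrite mem_iota => /andP[j1 jq].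
  by rewrite /ruler_block -E logn2_expD // E; lia.
rewrite /= cats0 /ruler_block -E addnn -mul2n -expnS !pfactorK //.
by rewrite -(addn1 k) nseqD.
Qed.

Lemma s_size_prefix l : s (size (ruler_list l)) = sumn (ruler_list l).
Proof.
have lk : l <= 2 ^ l by rewrite ltnW // ltn_expl.
have pre : Alist l.+1 = ruler_list l ++ drop (size (ruler_list l)) (Alist l.+1).
  by rewrite Alist_ruler -[in 2 ^ l](subnKC lk) ruler_listD drop_size_cat.
rewrite /s big_nat_recl // (add0n _) sumnE [RHS](big_nth 0).
apply: eq_big_nat => i /andP[_ il].
rewrite (@aE l.+1); first by rewrite pre nth_cat il.
by rewrite pre size_cat ltn_addr.
Qed.

Lemma s_add m d : s m + d <= s (m + d).
Proof.
elim: d => [|d IH]; first by rewrite !addn0.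
rewrite !addnS {2}/s big_nat_recr // -/(s _).
by apply: leq_trans (leq_add IH (a_gt0 (m + d))); rewrite addn1.
Qed.

(** The first [l = n./2./2] blocks have exactly [saving n] entries, with sum
    [4 * l + saving n <= n + saving n]. Dropping the last [saving n - k] entries, each at least 1,
    lowers the sum by at least that many. *)
Lemma s_le_saving n k : k <= saving n -> s k <= n + k.
Proof.
move=> kn; set l := n./2./2.
have Sl : saving n = size (ruler_list l).
  by rewrite size_ruler_list /saving logn2_fact.
have := s_add k (saving n - k); rewrite subnKC // {2}Sl s_size_prefix.
rewrite sumn_ruler_list; move: Sl; rewrite size_ruler_list.
by have : 4 * l <= n by [rewrite /l; lia]; lia.
Qed.

(** * Shortest paths *)

Section Distance.

Variables (V : finType) (e : rel V).
Hypothesis e_connected : connected_graph e.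

Lemma gdist_le_path x p : path e x p -> gdist e x (last x p) <= size p.
Proof.
move=> xp; have [lt|ge] := ltnP (size p) #|V|; last first.
  (* A long path is harmless: [gdist] never exceeds its default value [#|V|]. *)
  by apply: leq_trans ge; rewrite -[X in _ <= X](size_iota 0) find_size.
rewrite leqNgt; apply/negP => /(before_find 0); rewrite nth_iota // add0n.
by move=> /= /existsP; apply; exists (in_tuple p); rewrite /= xp eqxx.
Qed.

Lemma gdist_path x y :
  exists p, [/\ path e x p, last x p = y & size p = gdist e x y].
Proof.
have /connectP[p0 xp0 ->] := e_connected x y.
case/shortenP: xp0 => p xp up _.
have lt : size p < #|V|.
  by rewrite -[_.+1]/(size (x :: p)) -(card_uniqP up) max_card.
have hs : has (fun n => [exists q : n.-tuple V,
    path e x q && (last x q == last x p)]) (iota 0 #|V|).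
  apply/hasP; exists (size p); first by rewrite mem_iota.
  by apply/existsP; exists (in_tuple p); rewrite /= xp eqxx.
have := nth_find 0 hs; rewrite nth_iota; last by move: hs; rewrite has_find size_iota.
by case/existsP=> q /andP[xq /eqP lq]; exists q; rewrite size_tuple.
Qed.

Lemma gdistxx x : gdist e x x = 0.
Proof. by apply/eqP; rewrite -leqn0 (@gdist_le_path x [::]). Qed.

Lemma gdist_eq0 x y : gdist e x y = 0 -> y = x.
Proof. by have [p [_ <- <-]] := gdist_path x y; case: p. Qed.

Lemma gdist_edge x u v : e u v -> gdist e x v <= (gdist e x u).+1.
Proof.
move=> uv; have [p [xp lp <-]] := gdist_path x u.
have := @gdist_le_path x (rcons p v).
by rewrite rcons_path xp lp uv last_rcons size_rcons; apply.
Qed.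

Lemma gdist_parent x v d : gdist e x v = d.+1 ->
  exists2 u, e u v & gdist e x u = d.
Proof.
move=> vd; have [p [xp lp]] := gdist_path x v; rewrite vd.
case/lastP: p xp lp => [//|p w]; rewrite rcons_path last_rcons size_rcons.
case/andP=> xp uw wv [sp]; rewrite {w}wv in uw.
exists (last x p) => //; apply/eqP; rewrite eqn_leq -{1}sp gdist_le_path //=.
by have := gdist_edge x uw; rewrite vd.
Qed.

End Distance.

(** * Levels and parents in a rooted tree *)

Section TreeLevels.

Variables (V : finType) (e : rel V) (r : V).
Hypothesis e_tree : is_tree e.

Let esym : symmetric e. Proof. by case: e_tree => [[]]. Qed.
Let e_connected : connected_graph e. Proof. by case: e_tree. Qed.
Let e_acyclic : acyclic_graph e. Proof. by case: e_tree. Qed.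
Local Notation dep := (gdist e r).

(** Climb from both vertices until the ancestors meet. The interior lies strictly above level [d],
    so the path is simple; being nonempty, it makes any cycle closed through it longer than 2. *)
Lemma same_level_path d v w : dep v = d -> dep w = d -> v != w ->
  exists p, [/\ path e v (rcons p w), uniq (v :: rcons p w), 0 < size p
                & all (fun u => dep u < d) p].
Proof.
elim: d v w => [|d IH] v w vd wd vw.
  by rewrite (gdist_eq0 e_connected vd) (gdist_eq0 e_connected wd) eqxx in vw.
have [v' ev v'd] := gdist_parent e_connected vd.
have [w' ew w'd] := gdist_parent e_connected wd.
have low u q : dep u = d.+1 -> all (fun z => dep z <= d) q -> u \notin q.
  by move=> ud /allP qd; apply/negP => /qd; rewrite ud ltnn.
have [E|v'w'] := eqVneq v' w'.
  have vv' : v != v' by apply: contra_eq_neq vd => ->; rewrite v'd; lia.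
  have v'w : v' != w by apply: contra_eq_neq wd => <-; rewrite v'd; lia.
  exists [:: v']; rewrite /= !inE negb_or vv' v'w vw v'd esym ev {1}E ew.
  by split; rewrite ?ltnSn.
have [p [pp up _ lp]] := IH _ _ v'd w'd v'w'.
have al : all (fun z => dep z <= d) (v' :: rcons p w').
  rewrite /= all_rcons v'd w'd !leqnn /=.
  by apply: sub_all lp => z /ltnW.
exists (v' :: rcons p w'); split=> //.
- by rewrite rcons_cons /= rcons_path pp last_rcons esym ev ew.
- by rewrite cons_uniq rcons_uniq up (low w) // mem_rcons inE negb_or vw low.
Qed.

Lemma edge_level u v : e u v -> dep v = (dep u).+1 \/ dep u = (dep v).+1.
Proof.
move=> uv; have vu : e v u by rewrite esym.
have := gdist_edge e_connected r uv; have := gdist_edge e_connected r vu.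
have [E _ _|] := eqVneq (dep u) (dep v); last by lia.
have uNv : u != v.
  by apply: contraTneq uv => ->; case: e_tree => [[_ ->]].
have [p [pp up p0 _]] := same_level_path E erefl uNv.
case: (@e_acyclic (u :: rcons p v)); first by rewrite /= size_rcons.
by rewrite /ucycle /cycle rcons_path pp last_rcons vu up.
Qed.

(** Two distinct parents would be joined by a path above their level, which [w], one level below
    them, would close into a cycle. *)
Lemma parent_uniq u v w : w \in children e r u -> w \in children e r v -> u = v.
Proof.
rewrite !inE => /andP[uw /eqP du] /andP[vw /eqP dv]; apply/eqP/negPn/negP => uv.
have E : dep u = dep v by lia.
have [p [pp up p0 lp]] := same_level_path E erefl uv.
have wNp : w \notin u :: rcons p v.
  rewrite inE mem_rcons inE; apply/or3P => -[/eqP Ew|/eqP Ew|/(allP lp)].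
  - by rewrite Ew in du; lia.
  - by rewrite Ew in dv; lia.
  - by rewrite dv; lia.
case: (@e_acyclic (w :: u :: rcons p v)); first by rewrite /= size_rcons.
rewrite /ucycle cons_uniq up wNp /cycle rcons_cons [path _ _ _]/= esym uw.
by rewrite rcons_path pp last_rcons vw.
Qed.

Lemma mem_children_uniq u w v :
  w \in children e r u -> (w \in children e r v) = (v == u).
Proof.
by move=> wu; apply/idP/eqP => [/(parent_uniq wu)->//|->].
Qed.

Lemma root_not_child v : r \notin children e r v.
Proof. by rewrite inE (gdistxx e r) andbF. Qed.

End TreeLevels.

(** * Pebbling as a flow on the complete binary tree *)

Section CompleteBinaryTree.

Variables (V : finType) (e : rel V) (r : V) (h : nat).
Hypothesis tree_h : complete_binary_tree e r h.

Let e_tree : is_tree e. Proof. by case: tree_h. Qed.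
Local Notation dep := (gdist e r).
Local Notation ch := (children e r).

Lemma depth_le v : dep v <= h.
Proof.
case: (@arg_maxnP _ r predT dep) => // u _ umax.
have /(_ u) : forall v, is_leaf e r v -> dep v = h by case: tree_h.
rewrite /is_leaf => <- //; first exact: umax.
apply/eqP/setP => w; rewrite !inE; apply/negP => /andP[_ /eqP dw].
by have := umax w isT; rewrite /= dw ltnn.
Qed.

Lemma children_eq0 v : dep v = h -> ch v = set0.
Proof.
move=> vh; apply/setP => w; rewrite !inE; apply/negP => /andP[_ /eqP dw].
by have := depth_le w; rewrite dw vh ltnn.
Qed.

Lemma children_two v : dep v < h -> exists c1 c2, c1 != c2 /\ ch v = [set c1; c2].
Proof.
move=> vh; have [_ two leaf] := tree_h.
by apply/cards2P/eqP/two; apply: contraTN vh => /leaf->; rewrite ltnn.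
Qed.

Lemma children_depth v c : c \in ch v -> dep c = (dep v).+1.
Proof. by rewrite inE => /andP[_ /eqP]. Qed.

Section Configuration.

Variable f : config V.

(* [up v] and [dn v] count the moves from [v] to its parent and back. *)
Lemma reachable_flow g : reachable e f g -> exists up dn : V -> nat,
  [/\ forall v, g v + 2 * (up v + \sum_(c in ch v) dn c)
                = f v + dn v + \sum_(c in ch v) up c,
      up r = 0 & dn r = 0].
Proof.
elim=> [|{}g u v _ [up [dn [bal up0 dn0]]] uv gu].
  by exists (fun=> 0), (fun=> 0); split=> // v; rewrite !big1 //; lia.
have uNv : (u == v) = false.
  by apply: contraTF uv => /eqP->; case: e_tree => [[_ ->]].
(* One more move along the edge from [b] to its parent [a] affects the child sum at [a] only,
   parents being unique. *)
have sum1 (a b : V) (F : V -> nat) : b \in ch a -> forall w,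
    \sum_(c in ch w) (F c + (c == b)) = \sum_(c in ch w) F c + (w == a).
  move=> ba w; rewrite big_split /=; congr (_ + _).
  rewrite -(mem_children_uniq e_tree w ba); have [bw|bw] := boolP (b \in ch w).
    rewrite (bigD1 b) //= eqxx big1 // => c /andP[_ /negPf->] //.
  by rewrite big1 // => c cw; case: eqP => // cb; rewrite cb (negPf bw) in cw.
have vu : e v u by case: e_tree => [[->]].
case: (edge_level r e_tree uv) => [dv|du].
  have vch : v \in ch u by rewrite inE uv dv eqxx.
  exists up, (fun c => dn c + (c == v)); split=> // [w|]; last first.
    by rewrite dn0 (_ : (r == v) = false) //; apply: contraTF vch => /eqP<-;
      exact: root_not_child.
  rewrite (sum1 _ _ _ vch) ffunE; have := bal w.
  by case: eqVneq => [->|_]; rewrite ?uNv; [lia|case: eqP; lia].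
have uch : u \in ch v by rewrite inE vu du eqxx.
exists (fun c => up c + (c == u)), dn; split=> // [w|]; last first.
  by rewrite up0 (_ : (r == u) = false) //; apply: contraTF uch => /eqP<-;
    exact: root_not_child.
rewrite (sum1 _ _ _ uch) ffunE; have := bal w.
by case: eqVneq => [->|_]; rewrite ?uNv; [lia|case: eqP; lia].
Qed.

(* Number of pebbles that the subtree of height [k] below [v] can bring to [v]. *)
Fixpoint gather k v :=
  f v + if k is k'.+1 then \sum_(c in ch v) (gather k' c)./2 else 0.

Fixpoint subtree_weight k v :=
  f v + if k is k'.+1 then \sum_(c in ch v) subtree_weight k' c else 0.

(* Every leaf below [v] is reachable once [x] extra pebbles are put on [v]. *)
Fixpoint covered k v x : Prop :=
  if k is k'.+1 then
    forall c, c \in ch v ->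
      covered k' c (f v + x + \sum_(b in ch v | b != c) (gather k' b)./2)./2
  else 0 < f v + x.

Lemma up_le_gather up dn g :
  (forall v, g v + 2 * (up v + \sum_(c in ch v) dn c)
                = f v + dn v + \sum_(c in ch v) up c) ->
  forall k v, dep v + k = h -> 2 * up v <= gather k v + dn v.
Proof.
move=> bal; elim=> [|k IH] v vk; have := bal v.
  by rewrite addn0 in vk; rewrite (children_eq0 vk) !big_set0 /=; lia.
(* A pebble sent down to [c] returns at most one, while [v] paid two for it. *)
have : \sum_(c in ch v) up c <= \sum_(c in ch v) ((gather k c)./2 + dn c).
  apply: leq_sum => c cv; have := children_depth cv => dc.
  by have := IH c; rewrite dc => /(_ ltac:(lia)); lia.
by rewrite big_split /=; lia.
Qed.

(** The hypothesis bounds by [x] the net flow entering [v] from its parent. It ranges over all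
    balanced flows, since each leaf may need its own sequence of moves. *)
Lemma covered_of_flow k v x : pebbles e f -> dep v + k = h ->
  (forall g up dn,
     (forall v, g v + 2 * (up v + \sum_(c in ch v) dn c)
                = f v + dn v + \sum_(c in ch v) up c) ->
     up r = 0 -> dn r = 0 -> dn v <= x + up v) ->
  covered k v x.
Proof.
move=> peb; elim: k v x => [|k IH] v x vk sup.
  have [g fg gv] := peb v; have [up [dn [bal up0 dn0]]] := reachable_flow fg.
  have := sup g up dn bal up0 dn0; have := bal v; rewrite addn0 in vk.
  by rewrite (children_eq0 vk) !big_set0 /=; lia.
move=> c cv; have dc := children_depth cv; apply: IH; first lia.
move=> g up dn bal up0 dn0; have := sup _ _ _ bal up0 dn0; have := bal v.
rewrite (bigD1 c) // [X in _ = _ + X](bigD1 c) //=.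
have : \sum_(b in ch v | b != c) up b
       <= \sum_(b in ch v | b != c) ((gather k b)./2 + dn b).
  apply: leq_sum => b /andP[bv _]; have db := children_depth bv.
  by have := up_le_gather bal (_ : dep b + k = h); rewrite db => /(_ ltac:(lia)); lia.
by rewrite big_split /=; lia.
Qed.

Lemma covered_root : pebbles e f -> covered h r 0.
Proof.
by move=> peb; apply: covered_of_flow => // [|g up dn _ -> ->]; rewrite ?gdistxx.
Qed.

Lemma covered_bound k v x : dep v + k = h -> covered k v x ->
  2 ^ k <= x + subtree_weight k v + saving (subtree_weight k v) /\
  2 ^ k.+1 + gather k v <= 2 * x + 3 * subtree_weight k v.
Proof.
elim: k v x => [|k IH] v x vk; first by rewrite /= expn1 expn0; lia.
have [c1 [c2 [c12 E]]] : exists c1 c2, c1 != c2 /\ ch v = [set c1; c2].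
  by apply: children_two; lia.
have d1 : dep c1 + k = h by rewrite (@children_depth v) ?E ?inE ?eqxx //; lia.
have d2 : dep c2 + k = h.
  by rewrite (@children_depth v) ?E ?inE ?eqxx ?orbT //; lia.
have sum2 (F : V -> nat) : \sum_(c in ch v) F c = F c1 + F c2.
  by rewrite E big_setU1 ?inE //= big_set1.
move=> /= cov; rewrite !sum2.
have := cov c1; rewrite {1}E set21 big_mkcondr sum2 eqxx eq_sym c12 add0n => /(_ isT).
have := cov c2; rewrite {1}E set22 big_mkcondr sum2 eqxx c12 addn0 => /(_ isT).
move=> {cov} /(IH _ _ d2)[B2 C2] /(IH _ _ d1)[B1 C1].
move: B1 B2 C1 C2; move: (subtree_weight k c1) (subtree_weight k c2) => n1 n2.
move: (gather k c1) (gather k c2) => m1 m2; rewrite !expnS => B1 B2 C1 C2.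
have S0 : saving (n1 + n2) <= saving (f v + (n1 + n2)).
  by apply: leq_saving; rewrite leq_addl.
(* The linear bound is C1 + C2: half of each [m1], [m2] goes to the other side, and the rest covers
   what [v] gathers. *)
move: (2 ^ k) B1 B2 C1 C2 => N B1 B2 C1 C2; split; last lia.
(* If [n1 <= n2], the combination B1 + C1/6 + C2/3 eliminates [m1] and [m2] and leaves
   [n1./2 + saving n1]; the other case is symmetric. *)
by have [/saving_add|/ltnW/saving_add] := leqP n1 n2; rewrite 1?[n2 + n1]addnC; lia.
Qed.

Lemma subtree_weight_le : subtree_weight h r <= weight f.
Proof.
(* The induction runs over whole levels, so that disjointness of subtrees reduces to uniqueness of
   parents. *)
have lev k d : d + k = h ->
    \sum_(v | dep v == d) subtree_weight k v <= \sum_(v | d <= dep v) f v.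
  elim: k d => [|k IH] d dk.
    rewrite [X in _ <= X](bigID (fun v => dep v == d)) /=.
    apply: leq_trans (leq_addr _ _); rewrite big_mkcond [X in _ <= X]big_mkcond /=.
    by apply: leq_sum => v _; case: eqP => // ->; rewrite leqnn addn0.
  have := IH d.+1; rewrite addSnnS => /(_ dk) {}IH.
  rewrite big_split /= [X in _ <= X](bigID (fun v => dep v == d)) /=.
  apply: leq_add.
    rewrite big_mkcond [X in _ <= X]big_mkcond /=.
    by apply: leq_sum => v _; case: eqP => // ->; rewrite leqnn.
  have -> : \sum_(v | (d <= dep v) && (dep v != d)) f v = \sum_(v | d < dep v) f v.
    by apply: eq_bigl => v; rewrite ltn_neqAle andbC eq_sym.
  apply: leq_trans IH.
  rewrite (exchange_big_dep (fun c => dep c == d.+1)) /=; last first.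
    by move=> v c /eqP<- /children_depth->.
  apply: leq_sum => c _; rewrite sum_nat_const -[X in _ <= X]mul1n leq_mul2r.
  apply/orP; right; apply/card_le1_eqP => u v /andP[_ cu] /andP[_ cv].
  exact: (parent_uniq e_tree cv cu).
have := lev h 0 erefl; rewrite (big_pred1 r) // => v; apply/eqP/eqP => [|->].
  by case: e_tree => _ e_connected _; exact: gdist_eq0.
exact: gdistxx.
Qed.

Lemma pebbles_weight : pebbles e f -> 2 ^ h <= weight f + saving (weight f).
Proof.
move=> /covered_root /covered_bound[]; first by rewrite gdistxx.
by have := subtree_weight_le => /[dup] /leq_saving; lia.
Qed.

End Configuration.

End CompleteBinaryTree.

Theorem theorem4p1 (h : nat) (V : finType) (e : rel V) (r : V) :
  0 < h -> complete_binary_tree e r h ->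
  2 ^ h - kmax h <= optimal_pebbling_number e.
Proof.
move=> _ tree_h; rewrite /optimal_pebbling_number; case: ex_minnP => n.
move=> /asboolP[f peb <-] _; have W := pebbles_weight tree_h peb.
have [le|/ltnW lt] := leqP (2 ^ h) (weight f).
  exact: leq_trans (leq_subr _ _) le.
(* By maximality of [kmax h], it suffices that [s k <= 2 ^ h] for [k = 2 ^ h - weight f], which is
   at most [saving (weight f)] by [W]. *)
rewrite leq_subCl /kmax; case: ex_maxnP => k _; apply.
rewrite -[X in _ <= X](subnKC lt); apply: s_le_saving.
by rewrite leq_subLR.
Qed.
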